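(* Let $r \geq 2$ be an integer and let $K, C > 0$ be real numbers. Let $A_1, \dots, A_r$ be finite nonempty subsets of an abelian group $\mathbf{G}$ and let $H \subseteq A_1 \times \cdots \times A_r$ be an $r$-partite $r$-uniform hypergraph with $\lvert E(H)\rvert \geq \frac{1}{K} \prod_{i\in [r]} \lvert A_i\rvert$ and $\left\lvert \bigoplus_H (A_1, \dots, A_r)\right\rvert \leq C\left(\prod_{i \in [r]} \lvert A_i\rvert \right)^{1/r}$. Then for each $i\in [r]$ there exists $A_i' \subseteq A_i$ such that (1) $\lvert A'_i\rvert \geq \frac{\lvert A_i\rvert}{2^{i+2} K}$ for each $i\in [r]$, and (2) $\lvert A_1' + \cdots + A_r'\rvert \leq 8^{r^3}(r-1)^{(r-1)}K^{(r^2 + 5r - 4)/2}C^{2r-1} \left(\prod_{i\in [r]} \lvert A_i\rvert \right)^{1/r}$.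
   Context: An $r$-partite $r$-uniform hypergraph $H \subseteq A_1\times\cdots\times A_r$ is a set $E(H)$ of ordered tuples $(a_1,\dots,a_r)$ with $a_i\in A_i$. For such $H$, $\bigoplus_H (A_1, \dots, A_r) \coloneqq \{\sum_{i\in [r]} a_i : (a_1, \dots, a_r) \in E(H)\}$. $A_1'+\cdots+A_r'$ denotes the sumset $\{a_1+\cdots+a_r : a_i\in A_i'\}$. *)

(* Defs.v *)
From mathcomp Require Export all_boot all_order all_algebra.
From mathcomp Require Export finmap reals exp.
Export GRing.Theory Num.Theory.

Set Implicit Arguments.
Unset Strict Implicit.
Unset Printing Implicit Defensive.

Local Open Scope fset_scope.
Local Open Scope ring_scope.

Section PartialSumset.
Variables (G : zmodType) (r : nat).

(* An ordered r-tuple (a_1, ..., a_r) is a : {ffun 'I_r -> G}, where the index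
   i : 'I_r is 0-based, so that a_i of the mathematics is a at ordinal i - 1.
   An r-partite r-uniform hypergraph H on parts A_1, ..., A_r is identified
   with its edge set, a finite subset of cartprod A. *)
Definition cartprod (A : 'I_r -> {fset G}) : {fset {ffun 'I_r -> G}} :=
  [fset [ffun i => val (f i)]
     | f : {dffun forall i : 'I_r, A i} in {: {dffun forall i : 'I_r, A i}}].

Lemma cartprodP (A : 'I_r -> {fset G}) (a : {ffun 'I_r -> G}) :
  reflect (forall i, a i \in A i) (a \in cartprod A).
Proof.
apply: (iffP (imfsetP _ _ _ _)) => [[f _ ->] i|aA]; first by rewrite ffunE; exact: valP.
exists [ffun i => FSetSub (aA i) : A i] => //.
by apply/ffunP => i; rewrite !ffunE.
Qed.

Definition hsum (H : {fset {ffun 'I_r -> G}}) : {fset G} :=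
  [fset \sum_(i < r) a i | a : {ffun 'I_r -> G} in H].

Definition sumset (A : 'I_r -> {fset G}) : {fset G} := hsum (cartprod A).

End PartialSumset.

(* Main.v *)
Require Import Defs.
From mathcomp Require Import all_boot all_order all_algebra.
From mathcomp Require Import finmap reals exp.
From mathcomp Require Import zify ring lra.

Import Order.TTheory.

Set Implicit Arguments.
Unset Strict Implicit.
Unset Printing Implicit Defensive.

Local Open Scope fset_scope.
Local Open Scope ring_scope.

(** Let S be the partial sumset of H.  Process the parts A_1, ..., A_{r-1} in
    order.  Viewing H as a dense bipartite graph between A_i and the product of
    the current parts, replace A_i by a typical neighborhood X_i: this halves
    the density at worst, and all but few pairs (a, b) in X_i have many common
    neighbors w, so that a - b = (a + w) - (b + w) has many representations as
    a difference of two elements of S.  Let A_i' consist of the a for which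
    a - b is popular in this sense for almost all b in X_i, and A_r' of the a_r
    with a dense link in X_1 x ... x X_{r-1}.  For a_i in A_i', most
    (b_1, ..., b_{r-1}) in the link of a_r have all a_i - b_i popular, and
      a_1 + ... + a_r = (b_1 + ... + b_{r-1} + a_r) + sum_{i<r} (a_i - b_i)
    then yields many (2r-1)-tuples of elements of S, from which the left-hand
    side can be recovered.  Comparing with |S|^(2r-1) bounds the sumset.  The
    popularity of a_i - b_i is bounded below by the size of a single other
    part; taking the largest part A_m for i <> m and A_r for i = m makes the
    sizes multiply up to at least the required power of the geometric mean. *)

Lemma sumr_const_seq (V : nmodType) (I : Type) (s : seq I) (x : V) :
  \sum_(i <- s) x = x *+ size s.
Proof. by rewrite big_const_seq count_predT iter_addr_0. Qed.

Section DoubleCounting.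
Variables T V : choiceType.
Implicit Types (A : {fset T}) (W : {fset V}) (e : T -> V -> bool).

Lemma card_fset_cond A (P : pred T) :
  #|` [fset a in A | P a]| = (\sum_(a <- A) P a)%N.
Proof. by rewrite card_fset_sum1 big_fset big_mkcond. Qed.

Lemma leq_card_fset_forall (I : finType) (P : I -> pred T) A :
  (#|` A| <= #|` [fset a in A | [forall i, P i a]]|
             + \sum_i #|` [fset a in A | ~~ P i a]|)%N.
Proof.
under eq_bigr do rewrite card_fset_cond.
rewrite card_fset_cond exchange_big -big_split card_fset_sum1.
apply: leq_sum => a _; case: (boolP [forall i, P i a]) => //= /forallPn[i nPi].
by rewrite (bigD1 i) //= nPi.
Qed.

Lemma double_counting e A W :
  (\sum_(a <- A) #|` [fset v in W | e a v]| =
   \sum_(v <- W) #|` [fset a in A | e a v]|)%N.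
Proof.
under eq_bigr do rewrite card_fset_sum1 big_fset big_mkcond.
rewrite exchange_big; apply: eq_bigr => v _.
by rewrite card_fset_cond -big_mkcond.
Qed.

Lemma card_fibers (g : V -> T) A W : {in W, forall v, g v \in A} ->
  (\sum_(a <- A) #|` [fset v in W | g v == a]| = #|` W|)%N.
Proof.
move=> gA; rewrite double_counting card_fset_sum1 big_seq [RHS]big_seq.
apply: eq_bigr => v /gA gvA; rewrite -[RHS](cardfs1 (g v)); congr #|` _|.
apply/fsetP => a; rewrite !inE eq_sym.
by case: eqP => [->|_]; rewrite ?gvA ?andbF.
Qed.

Lemma leq_sum_card_unique e A W :
  (forall v, v \in W -> {in A &, forall a b, e a v -> e b v -> a = b}) ->
  (\sum_(a <- A) #|` [fset v in W | e a v]| <= #|` W|)%N.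
Proof.
move=> e_unique; rewrite double_counting card_fset_sum1 big_seq [leqRHS]big_seq.
apply: leq_sum => v vW; set A_v := [fset a in A | e a v].
have [->|[a]] := fset_0Vmem A_v; first by rewrite cardfs0.
rewrite !inE => /andP[aA eav]; rewrite -(cardfs1 a); apply: fsubset_leq_card.
apply/fsubsetP => b; rewrite !inE => /andP[bA ebv]; apply/eqP.
exact: e_unique vW _ _ _ _ ebv eav.
Qed.

Lemma big_fsetM (R : Type) (idx : R) (op : Monoid.com_law idx) A W
    (F : T * V -> R) :
  \big[op/idx]_(p <- A `*` W) F p =
  \big[op/idx]_(a <- A) \big[op/idx]_(v <- W) F (a, v).
Proof. by rewrite big_imfset2 //= => -[a v] [b w] _ _ /= [-> ->]. Qed.

Lemma card_fsetM A W : #|` A `*` W| = (#|` A| * #|` W|)%N.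
Proof. by rewrite !card_fset_sum1 big_fsetM big_distrlr. Qed.

End DoubleCounting.

Section Averages.
Variable R : realDomainType.

Lemma sqr_sum_le_size_sum_sqr (I : Type) (s : seq I) (F : I -> R) :
  (\sum_(i <- s) F i) ^+ 2 <= (size s)%:R * \sum_(i <- s) F i ^+ 2.
Proof.
have: 0 <= \sum_(i <- s) \sum_(j <- s) (F i - F j) ^+ 2.
  by apply: sumr_ge0 => i _; apply: sumr_ge0 => j _; exact: sqr_ge0.
under eq_bigr => i _.
  under eq_bigr do rewrite sqrrB.
  rewrite big_split sumrB sumr_const_seq sumrMnl -mulr_sumr; over.
rewrite big_split sumrB !sumrMnl -mulr_suml sumr_const_seq /=.
by rewrite -expr2 -mulr_natl; lra.
Qed.

Lemma exists_ge_average (I : eqType) (s : seq I) (F : I -> R) (c : R) :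
  s != [::] -> c * (size s)%:R <= \sum_(i <- s) F i ->
  exists2 i, i \in s & c <= F i.
Proof.
case: s => [//|x s _] cF; apply/hasP; apply: contraLR cF => /hasPn F_lt.
rewrite -ltNge mulr_natr -sumr_const_seq big_seq [ltRHS]big_seq.
apply: ltr_sum => [|i /F_lt]; last by rewrite ltNge.
by rewrite /= mem_head.
Qed.

Lemma sum_popular_ge (I : Type) (s : seq I) (F : I -> R) (t : R) :
  0 <= t ->
  \sum_(i <- s) F i - t * (size s)%:R <= \sum_(i <- s | t <= F i) F i.
Proof.
move=> t_ge0; rewrite mulr_natr -sumr_const_seq -sumrB [leRHS]big_mkcond.
by apply: ler_sum => i _; case: (leP t (F i)) => ?; lra.
Qed.

Lemma exists_ge_geometric_mean n (x : 'I_n.+1 -> R) (N : R) :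
  (forall i, 0 <= x i) -> N ^+ n.+1 = \prod_i x i -> exists m, N <= x m.
Proof.
move=> x_ge0 N_mean; apply/existsP.
have [//|/existsPn x_lt] := boolP [exists m, N <= x m].
suff: \prod_i x i < N ^+ n.+1 by rewrite N_mean ltxx.
rewrite -[n.+1 in ltRHS]card_ord -prodr_const; apply: ltr_prod => [|i _].
  by apply/hasP; exists ord0; rewrite ?mem_index_enum.
by rewrite x_ge0 ltNge x_lt.
Qed.

End Averages.

Lemma half_le_twice_average (R : realFieldType) (I : choiceType) (A : {fset I})
    (F : I -> R) (c : R) :
  0 < c -> (forall i, 0 <= F i) -> \sum_(i <- A) F i <= c * #|` A|%:R ->
  #|` A|%:R / 2 <= #|` [fset i in A | F i <= 2 * c]|%:R :> R.
Proof.
move=> c_gt0 F_ge0 F_le; rewrite -(ler_pM2l c_gt0).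
rewrite card_fset_cond natr_sum mulr_sumr.
have: \sum_(i <- A) (2 * c - F i) / 2
    <= \sum_(i <- A) c * (F i <= 2 * c)%R%:R.
  apply: ler_sum => i _; have := F_ge0 i.
  by case: (leP (F i) (2 * c)) => /= ?; lra.
rewrite -mulr_suml sumrB sumr_const_seq -[_ *+ _]mulr_natr.
by apply: le_trans; lra.
Qed.

Section DependentRandomChoice.
Variables (R : realFieldType) (T V : choiceType) (e : T -> V -> bool).
Variable W : {fset V}.
Implicit Types (A : {fset T}) (t : R).

Definition nbrs (a : T) : {fset V} := [fset v in W | e a v].

Definition few_common t (a b : T) : bool :=
  #|` [fset v in W | e a v && e b v]|%:R < t.

Lemma sum_few_common_le A t : 0 <= t ->
  \sum_(v <- W) \sum_(a <- [fset a in A | e a v])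
     #|` [fset b in [fset a in A | e a v] | few_common t a b]|%:R
  <= t * #|` A|%:R ^+ 2.
Proof.
move=> t_ge0.
have few_at v : \sum_(a <- [fset a in A | e a v])
     #|` [fset b in [fset a in A | e a v] | few_common t a b]|%:R
   = \sum_(a <- A) \sum_(b <- A) (few_common t a b && (e a v && e b v))%:R :> R.
  rewrite big_fset big_mkcond; apply: eq_bigr => a _.
  rewrite card_fset_cond natr_sum big_fset big_mkcond /=.
  case: (e a v) => /=; last by rewrite big1 // => b _; rewrite andbF.
  by apply: eq_bigr => b _; case: (e b v); rewrite ?andbT ?andbF.
under eq_bigr do rewrite few_at.
rewrite exchange_big expr2 mulrA [t * _]mulr_natr -sumr_const_seq mulr_suml /=.
apply: ler_sum => a _.
rewrite exchange_big mulr_natr -sumr_const_seq /=; apply: ler_sum => b _.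
have [few|_] := boolP (few_common t a b); last by rewrite big1.
by rewrite -natr_sum -card_fset_cond; exact: ltW few.
Qed.

(* A pair with few common neighbors lies in few neighborhoods, so the
   neighborhood of a typical [v] contains few such pairs. *)
Lemma exists_large_nbhd_few_common A (c eps t : R) :
  W != fset0 -> 0 <= c -> 0 < eps -> 0 <= t ->
  t * #|` A|%:R ^+ 2 <= eps * (c ^+ 2 / 2) ->
  c * #|` W|%:R <= \sum_(a <- A) #|` nbrs a|%:R ->
  exists N : {fset T},
    [/\ N `<=` A, c ^+ 2 / 2 <= #|` N|%:R ^+ 2
      & \sum_(a <- N) #|` [fset b in N | few_common (t * #|` W|%:R) a b]|%:R
          <= eps * #|` N|%:R * #|` N|%:R].
Proof.
move=> W_neq0 c_ge0 eps_gt0 t_ge0 tA degrees.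
have cW_gt0 : 0 < #|` W|%:R :> R by rewrite ltr0n cardfs_gt0.
pose N v := [fset a in A | e a v].
pose few v : R :=
  \sum_(a <- N v) #|` [fset b in N v | few_common (t * #|` W|%:R) a b]|%:R.
have few_ge0 v : 0 <= few v by exact: sumr_ge0.
have sum_few : \sum_(v <- W) few v <= eps * (c ^+ 2 / 2) * #|` W|%:R.
  have tW_ge0 : 0 <= t * #|` W|%:R by rewrite mulr_ge0.
  apply: le_trans (sum_few_common_le A tW_ge0) _.
  by rewrite mulrAC; apply: ler_wpM2r.
have sum_sqr : c ^+ 2 * #|` W|%:R <= \sum_(v <- W) #|` N v|%:R ^+ 2.
  rewrite -natr_sum double_counting natr_sum in degrees.
  rewrite -(ler_pM2r cW_gt0) -mulrA -expr2 -exprMn [leRHS]mulrC.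
  apply: le_trans (sqr_sum_le_size_sum_sqr _ _).
  by rewrite lerXn2r ?nnegrE ?sumr_ge0 // mulr_ge0.
have [||v _ Nv] := @exists_ge_average R V W
    (fun v => eps * #|` N v|%:R ^+ 2 - few v) (eps * (c ^+ 2 / 2)).
- by rewrite -size_eq0 cardfs_eq0.
- rewrite sumrB -mulr_sumr.
  by move: sum_few (ler_wpM2l (ltW eps_gt0) sum_sqr); lra.
have ec_ge0 : 0 <= eps * (c ^+ 2 / 2).
  by rewrite mulr_ge0 ?divr_ge0 ?sqr_ge0 // ltW.
exists (N v); split.
- by apply/fsubsetP => a; rewrite !inE => /andP[].
- by rewrite -(ler_pM2l eps_gt0); move: (few_ge0 v) Nv; lra.
- by rewrite -mulrA -expr2 -/(few v); move: Nv; lra.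
Qed.

(* Only vertices of degree at least half the average are kept, so that every
   subset of them still spans a dense graph. *)
Lemma dense_neighborhood A (d eps : R) :
  0 < d -> 0 < eps -> A != fset0 -> W != fset0 ->
  d * #|` A|%:R * #|` W|%:R <= \sum_(a <- A) #|` nbrs a|%:R ->
  exists B A' : {fset T},
    [/\ A' `<=` B /\ B `<=` A, d / 4 * #|` A|%:R <= #|` B|%:R,
        d / 8 * #|` A|%:R <= #|` A'|%:R,
        d / 2 * #|` B|%:R * #|` W|%:R <= \sum_(a <- B) #|` nbrs a|%:R
      & {in A', forall a,
          #|` [fset b in B | few_common (eps * d ^+ 2 / 8 * #|` W|%:R) a b]|%:R
          <= 2 * eps * #|` B|%:R}].
Proof.
move=> d_gt0 eps_gt0 A_neq0 W_neq0 degrees.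
have [d_ge0 eps_ge0] := (ltW d_gt0, ltW eps_gt0).
have cA_gt0 : 0 < #|` A|%:R :> R by rewrite ltr0n cardfs_gt0.
pose A_high := [fset a in A | d / 2 * #|` W|%:R <= #|` nbrs a|%:R].
have high_sub : A_high `<=` A by apply/fsubsetP => a; rewrite !inE => /andP[].
have card_high : #|` A_high|%:R <= #|` A|%:R :> R.
  by rewrite ler_nat fsubset_leq_card.
have high_degrees : d / 2 * #|` A|%:R * #|` W|%:R
    <= \sum_(a <- A_high) #|` nbrs a|%:R.
  rewrite big_fset /=; apply: le_trans (sum_popular_ge _ _ _); last first.
    by rewrite !mulr_ge0 ?invr_ge0.
  by move: degrees; lra.
have [||| N [N_sub N_sqr few_le]] := exists_large_nbhd_few_common
    (t := eps * d ^+ 2 / 8) W_neq0 _ eps_gt0 _ _ high_degrees.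
- by rewrite !mulr_ge0 ?invr_ge0.
- by rewrite !mulr_ge0 ?exprn_ge0 ?invr_ge0.
- rewrite exprMn expr_div_n -!mulrA !ler_wpM2l //.
  have : #|` A_high|%:R ^+ 2 <= #|` A|%:R ^+ 2 :> R by rewrite lerXn2r ?nnegrE.
  by lra.
have N_ge : d / 4 * #|` A|%:R <= #|` N|%:R.
  rewrite -(@ler_pXn2r _ 2) ?nnegrE ?mulr_ge0 ?invr_ge0 //.
  by move: N_sqr (sqr_ge0 (d * #|` A|%:R)); rewrite !exprMn; lra.
have epsN_gt0 : 0 < eps * #|` N|%:R.
  by rewrite mulr_gt0 //; apply: lt_le_trans N_ge; rewrite !mulr_gt0 ?invr_gt0.
have half_N := half_le_twice_average epsN_gt0 (fun=> ler0n _ _) few_le.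
set A' := [fset a in N | _] in half_N; exists N, A'; split.
- split; first by apply/fsubsetP => a; rewrite !inE => /andP[].
  exact: fsubset_trans N_sub high_sub.
- exact: N_ge.
- by apply: (le_trans _ half_N); lra.
- rewrite mulrAC mulr_natr -sumr_const_seq big_seq [leRHS]big_seq.
  by apply: ler_sum => a /(fsubsetP N_sub); rewrite !inE => /andP[].
- by move=> a; rewrite /A' !inE -!mulrA => /andP[].
Qed.

End DependentRandomChoice.

Definition ffun_upd (I : finType) (T : Type) (f : {ffun I -> T}) (i : I)
  (x : T) : {ffun I -> T} := [ffun j => if j == i then x else f j].

Section CartesianProducts.
Variables (G : zmodType) (r : nat).
Implicit Types (X : 'I_r -> {fset G}) (B : {fset G}) (i : 'I_r).

Lemma card_cartprod X : #|` cartprod X| = (\prod_i #|` X i|)%N.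
Proof.
rewrite card_imfset /= => [|f g /ffunP fg]; last first.
  by apply/ffunP => i; apply: val_inj; have := fg i; rewrite !ffunE.
rewrite -cardE card_dep_ffun foldrE big_map -big_enum /=.
by apply: eq_bigr => i _; rewrite cardfE.
Qed.

Lemma cartprod_upd_id X i : cartprod [eta X with i |-> X i] = cartprod X.
Proof.
apply/fsetP => f; apply/cartprodP/cartprodP => fX j; have := fX j => /=;
by case: eqP => // ->.
Qed.

(* Exchanging the coordinate [v i] with a separate value [a] lets [v] range
   over a whole box instead of a product of the parts other than the [i]-th. *)
Lemma big_cartprod_swap (R : Type) (idx : R) (op : Monoid.com_law idx) X i B
    (F : {ffun 'I_r -> G} -> R) :
  \big[op/idx]_(a <- B) \big[op/idx]_(v <- cartprod X) F (ffun_upd v i a) =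
  \big[op/idx]_(x <- X i) \big[op/idx]_(f <- cartprod [eta X with i |-> B]) F f.
Proof.
pose swap (p : G * {ffun 'I_r -> G}) := (p.2 i, ffun_upd p.2 i p.1).
have swapK : involutive swap.
  move=> [a v]; rewrite /swap /= ffunE eqxx; congr (_, _).
  by apply/ffunP => j; rewrite !ffunE; case: eqP => // ->.
have swap_sub Y C p : p \in C `*` cartprod Y ->
    swap p \in Y i `*` cartprod [eta Y with i |-> C].
  rewrite !inE => /andP[pC /cartprodP pY]; rewrite /= pY.
  by apply/cartprodP => j; rewrite ffunE /=; case: eqP.
have -> : \big[op/idx]_(x <- X i)
      \big[op/idx]_(f <- cartprod [eta X with i |-> B]) F f =
    \big[op/idx]_(p <- swap @` (B `*` cartprod X)) F p.2.
  rewrite -(big_fsetM _ _ _ (fun p => F p.2)).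
  congr (\big[_/_]_(p <- enum_fset _) _); apply/fsetP => p.
  apply/idP/imfsetP => [p_in|[q q_in ->]]; last exact: swap_sub.
  exists (swap p); rewrite ?swapK //; have := swap_sub _ _ _ p_in.
  rewrite /= eqxx inE => /andP[pB /cartprodP pX]; rewrite inE pB.
  by apply/cartprodP => j; have := pX j; rewrite /=; case: eqP => // ->.
by rewrite big_imfset /= ?big_fsetM // => p q _ _ /(inv_inj swapK).
Qed.

Lemma sum_card_slices X i B (P : pred {ffun 'I_r -> G}) :
  (\sum_(a <- B) #|` [fset v in cartprod X | P (ffun_upd v i a)]| =
   #|` X i| * #|` [fset f in cartprod [eta X with i |-> B] | P f]|)%N.
Proof.
under eq_bigr do rewrite card_fset_cond.
rewrite (big_cartprod_swap _ _ _ _ (fun f => P f : nat)).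
rewrite [#|` X i|]card_fset_sum1 big_distrl; apply: eq_bigr => x _.
by rewrite /= mul1n card_fset_cond.
Qed.

Lemma card_cartprod_upd X i B :
  (#|` X i| * #|` cartprod [eta X with i |-> B]| = #|` B| * #|` cartprod X|)%N.
Proof.
rewrite !card_cartprod (bigD1 i) //= eqxx [in RHS](bigD1 i) //= mulnCA.
by congr (_ * (_ * _))%N; apply: eq_bigr => j /negPf->.
Qed.

End CartesianProducts.

Definition diff_reps (G : zmodType) (S : {fset G}) (z : G) : {fset G * G} :=
  [fset p in S `*` S | p.1 - p.2 == z].

Section TypicalParts.
Variables (R : realFieldType) (G : zmodType) (r : nat).
Variable H : {fset {ffun 'I_r -> G}}.
Implicit Types (A X : 'I_r -> {fset G}) (v f : {ffun 'I_r -> G}) (i : 'I_r).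
Implicit Types (t d eps : R).

Lemma mem_hsum f : f \in H -> \sum_i f i \in hsum H.
Proof. by move=> fH; exact: in_imfset. Qed.

Lemma sum_ffun_upd v i a :
  \sum_j ffun_upd v i a j = a + \sum_(j | j != i) v j.
Proof.
rewrite (bigD1 i) //= ffunE eqxx; congr (_ + _).
by apply: eq_bigr => j /negPf ji; rewrite ffunE ji.
Qed.

(* For [x] in [X l] and [v] completing both [a] and [b] to edges, the two edge
   sums and the point [ffun_upd v l x] determine [x] and [v]. *)
Lemma card_common_le_diff_reps X i l a b : l != i ->
  (#|` X l| * #|` [fset v in cartprod X | (ffun_upd v i a \in H)
                                          && (ffun_upd v i b \in H)]|
   <= #|` diff_reps (hsum H) (a - b)| * #|` cartprod X|)%N.
Proof.
move=> li; set D := [fset v in _ | _]; rewrite -!card_fsetM.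
pose g (p : G * {ffun 'I_r -> G}) :=
  ((\sum_j ffun_upd p.2 i a j, \sum_j ffun_upd p.2 i b j), ffun_upd p.2 l p.1).
have g_inj : injective g.
  move=> [x v] [y w] [/eqP sum_vw _ /ffunP upd_vw].
  have vw j : j != l -> v j = w j.
    by move=> /negPf jl; have := upd_vw j; rewrite !ffunE jl.
  have xy : x = y by have := upd_vw l; rewrite !ffunE eqxx.
  rewrite xy; congr (_, _); apply/ffunP => j; have [->|/vw//] := eqVneq j l.
  move: sum_vw; rewrite !sum_ffun_upd (inj_eq (addrI _)).
  rewrite (bigD1 l) //= [eqbRHS](bigD1 l) //=.
  rewrite (eq_bigr w) => [/eqP/addIr//|k /andP[_]]; exact: vw.
have -> : #|` X l `*` D| = #|` g @` (X l `*` D)| by rewrite card_imfset.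
apply: fsubset_leq_card; apply/fsubsetP => _ /imfsetP[[x v] /= + ->].
rewrite !inE /= => /and3P[xX /cartprodP vX /andP[vaH vbH]].
rewrite !mem_hsum //= !sum_ffun_upd opprD addrACA subrr addr0 eqxx /=.
by apply/cartprodP => j; rewrite ffunE; case: eqP => // ->.
Qed.

Definition edge_dense d X : Prop :=
  d * #|` cartprod X|%:R <= #|` [fset f in cartprod X | f \in H]|%:R.

Lemma edge_dense_le1 d X :
  (forall i, X i != fset0) -> edge_dense d X -> d <= 1.
Proof.
move=> X_neq0 dX; have cX : 0 < #|` cartprod X|%:R :> R.
  by rewrite ltr0n card_cartprod prodn_gt0 // => i; rewrite cardfs_gt0.
rewrite -(ler_pM2r cX) mul1r; apply: le_trans dX _; rewrite ler_nat.
by apply: fsubset_leq_card; apply/fsubsetP => f; rewrite !inE => /andP[].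
Qed.

Definition popular t X i (z : G) : bool :=
  [forall l, (l != i) ==> (t * #|` X l|%:R <= #|` diff_reps (hsum H) z|%:R)].

Lemma popular_mono t t' X X' i z : 0 <= t' <= t ->
  (forall l, l != i -> X' l `<=` X l) -> popular t X i z -> popular t' X' i z.
Proof.
move=> /andP[t'_ge0 t't] X'X /forallP Xz.
apply/forallP => l; apply/implyP => li.
have /implyP/(_ li) := Xz l; apply: le_trans; apply: ler_pM => //.
by rewrite ler_nat fsubset_leq_card ?X'X.
Qed.

(* [X i] is what remains of the part [Ai], and [Ai'] is the subset of [X i] of
   the conclusion. *)
Definition typical t eps d X i (Ai Ai' : {fset G}) : Prop :=
  [/\ Ai' `<=` X i, d / 4 * #|` Ai|%:R <= #|` X i|%:R,
      d / 8 * #|` Ai|%:R <= #|` Ai'|%:R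
    & {in Ai', forall a,
        #|` [fset b in X i | ~~ popular t X i (a - b)]|%:R
        <= 2 * eps * #|` X i|%:R}].

Lemma typical_mono t t' eps d X X' i Ai Ai' : 0 <= t' <= t ->
  X' i = X i -> (forall l, X' l `<=` X l) ->
  typical t eps d X i Ai Ai' -> typical t' eps d X' i Ai Ai'.
Proof.
move=> tt' X'i X'X [Ai'X cX cAi' few]; split; rewrite ?X'i //.
move=> a /few; apply: le_trans; rewrite ler_nat; apply: fsubset_leq_card.
apply/fsubsetP => b; rewrite !inE => /andP[-> /=]; apply: contra.
exact: popular_mono.
Qed.

Lemma typical_neq0 t eps d X i Ai Ai' :
  0 < d -> Ai != fset0 -> typical t eps d X i Ai Ai' -> X i != fset0.
Proof.
move=> d_gt0 Ai_neq0 [_ cX _ _].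
rewrite -cardfs_gt0 -(ltr0n R); apply: lt_le_trans cX.
by rewrite mulr_gt0 ?ltr0n ?cardfs_gt0 // divr_gt0.
Qed.

Lemma edge_dense_typical X i d eps :
  0 < d -> 0 < eps -> (forall j, X j != fset0) -> edge_dense d X ->
  exists Xi' Ai' : {fset G}, let X' := [eta X with i |-> Xi'] in
    [/\ Xi' `<=` X i, edge_dense (d / 2) X'
      & typical (eps * d ^+ 2 / 8) eps d X' i (X i) Ai'].
Proof.
move=> d_gt0 eps_gt0 X_neq0 dX.
have cX_gt0 j : 0 < #|` X j|%:R :> R by rewrite ltr0n cardfs_gt0.
have box_gt0 : (0 < #|` cartprod X|)%N.
  by rewrite card_cartprod prodn_gt0 // => j; rewrite cardfs_gt0.
have [||Xi' [Ai' [[Ai'X Xi'X] cXi' cAi' degrees few]]] := dense_neighborhood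
    (e := fun a v => ffun_upd v i a \in H) (W := cartprod X)
    d_gt0 eps_gt0 (X_neq0 i).
- by rewrite -cardfs_gt0.
- rewrite -natr_sum (sum_card_slices _ _ _ (mem H)) cartprod_upd_id natrM.
  by rewrite mulrAC mulrC ler_wpM2l.
exists Xi', Ai'; split=> //.
  rewrite /edge_dense -(ler_pM2l (cX_gt0 i)) -natrM -sum_card_slices natr_sum.
  apply: le_trans degrees.
  by rewrite mulrCA -natrM card_cartprod_upd natrM mulrA.
rewrite /typical /= eqxx; split=> // a /few; apply: le_trans.
rewrite ler_nat; apply: fsubset_leq_card; apply/fsubsetP => b.
rewrite !inE => /andP[-> /= /forallPn[l]]; rewrite negb_imply => /andP[li].
rewrite /= (negPf li) -ltNge /few_common => few_reps.
rewrite -(ltr_pM2l (cX_gt0 l)) -natrM.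
apply: (@le_lt_trans _ _
    (#|` diff_reps (hsum H) (a - b)| * #|` cartprod X|)%:R).
  by rewrite ler_nat card_common_le_diff_reps.
by rewrite natrM mulrCA mulrA ltr_pM2r ?ltr0n.
Qed.

Lemma exists_typical A d eps k :
  0 < d -> 0 < eps -> (forall i, A i != fset0) -> edge_dense d A ->
  (k <= r)%N ->
  exists X A' : 'I_r -> {fset G},
    [/\ forall i, X i `<=` A i, forall i, (k <= i)%N -> X i = A i,
        edge_dense (d / 2 ^+ k) X
      & forall i, (i < k)%N -> typical (eps * (d / 2 ^+ k) ^+ 2 / 8) eps
                                 (d / 2 ^+ i) X i (A i) (A' i)].
Proof.
move=> d_gt0 eps_gt0 A_neq0 dA; elim: k => [_|k IHk k_lt].
  by exists A, A; split; rewrite ?expr0 ?divr1.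
have [X [A' [XA XE dX typX]]] := IHk (ltnW k_lt).
pose i0 := Ordinal k_lt.
have dk_gt0 j : 0 < d / 2 ^+ j by rewrite divr_gt0 ?exprn_gt0.
have X_neq0 i : X i != fset0.
  by have [/XE->//|/typX/typical_neq0->] := leqP k i.
have [Y [Z [YX dY typY]]] :=
  edge_dense_typical i0 (dk_gt0 k) eps_gt0 X_neq0 dX.
have Y_sub l : [eta X with i0 |-> Y] l `<=` X l.
  by rewrite /=; case: eqP => // ->.
have t_le : 0 <= eps * (d / 2 ^+ k.+1) ^+ 2 / 8 <= eps * (d / 2 ^+ k) ^+ 2 / 8.
  apply/andP; split; first by rewrite divr_ge0 // mulr_ge0 ?sqr_ge0 // ltW.
  rewrite ler_pM2r ?invr_gt0 // ler_pM2l //.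
  rewrite lerXn2r ?nnegrE ?(ltW (dk_gt0 _)) //.
  by rewrite ler_pM2l // lef_pV2 ?posrE ?exprn_gt0 // ler_eXn2l ?ltr1n.
exists [eta X with i0 |-> Y], [eta A' with i0 |-> Z]; split.
- by move=> l; exact: fsubset_trans (Y_sub l) (XA l).
- by move=> i ki; rewrite /= -val_eqE /= gtn_eqF // XE // ltnW.
- by rewrite exprSr invfM mulrA.
move=> i; rewrite ltnS leq_eqVlt => /orP[/eqP ik|ik].
  have -> : i = i0 by exact: val_inj.
  rewrite [Z' in typical _ _ _ _ _ _ Z']/= eqxx -(XE i0) //.
  exact: typical_mono typY.
rewrite [Z' in typical _ _ _ _ _ _ Z']/= -val_eqE /= ltn_eqF //.
apply: typical_mono (typX i ik) => //=.
by rewrite -val_eqE /= ltn_eqF.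
Qed.

End TypicalParts.

Definition sum_diff_reps (G : zmodType) n (S : {fset G}) (q : G) :
  {fset G * {ffun 'I_n -> G * G}} :=
  [fset p in S `*` cartprod (fun=> S `*` S)
     | p.1 + \sum_j ((p.2 j).1 - (p.2 j).2) == q].

Lemma sum_card_sum_diff_reps_le (G : zmodType) n (S Q : {fset G}) :
  (\sum_(q <- Q) #|` sum_diff_reps n S q| <= #|` S| ^ (2 * n).+1)%N.
Proof.
apply: leq_trans (leq_sum_card_unique _) _ => [p _ q q' _ _ /eqP<- /eqP//|].
rewrite card_fsetM card_cartprod prod_nat_const card_ord card_fsetM.
by rewrite mulnn -expnM expnS.
Qed.

(* Splits [\sum_i a i] as [\sum_i f i + \sum_(i != o) (a i - f i)]. *)
Lemma sum_prod_diff_reps_le (G : zmodType) n (o : 'I_n.+1) (S : {fset G})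
    (a : {ffun 'I_n.+1 -> G}) (D : {fset {ffun 'I_n.+1 -> G}}) :
  {in D, forall f : {ffun 'I_n.+1 -> G}, \sum_i f i \in S /\ f o = a o} ->
  (\sum_(f <- D) \prod_(j < n) #|` diff_reps S (a (lift o j) - f (lift o j))%R|
   <= #|` sum_diff_reps n S (\sum_i a i)%R|)%N.
Proof.
move=> D_sum; set P := sum_diff_reps _ _ _.
pose diffs f j := diff_reps S (a (lift o j) - f (lift o j)).
apply: (@leq_trans
    (\sum_(f <- D) #|` [fset p in P | p.2 \in cartprod (diffs f)]|)%N).
  rewrite big_seq [leqRHS]big_seq; apply: leq_sum => f /D_sum[fS fo].
  rewrite -card_cartprod.
  have -> : #|` cartprod (diffs f)|
      = #|` [fset (\sum_i f i, g) | g in cartprod (diffs f)]|.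
    by rewrite [RHS]card_imfset // => g g' [].
  apply: fsubset_leq_card; apply/fsubsetP => _ /imfsetP[g /= g_diffs ->].
  rewrite !inE fS g_diffs andbT /=; move/cartprodP: g_diffs => g_diffs.
  apply/andP; split.
    by apply/cartprodP => j; have := g_diffs j; rewrite !inE => /andP[].
  rewrite (bigD1_ord o) //= [eqbRHS](bigD1_ord o) //= fo -addrA -big_split /=.
  rewrite (eq_bigr (fun j => a (lift o j))) // => j _.
  by have := g_diffs j; rewrite !inE => /andP[_ /eqP->]; rewrite addrC subrK.
apply: leq_sum_card_unique => p _ f f' /D_sum[_ fo] /D_sum[_ f'o].
move=> /cartprodP pf /cartprodP pf'; apply/ffunP => i.
case: (unliftP o i) => [j ->|->]; last by rewrite fo f'o.
have := pf j; have := pf' j; rewrite !inE => /andP[_ /eqP->] /andP[_].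
by rewrite (inj_eq (addrI _)) eqr_opp => /eqP.
Qed.

Section Links.
Variables (R : realFieldType) (G : zmodType) (n : nat) (o : 'I_n.+1).
Variables (H : {fset {ffun 'I_n.+1 -> G}}) (X : 'I_n.+1 -> {fset G}).
Hypothesis X_neq0 : forall i, X i != fset0.
Implicit Types (a f : {ffun 'I_n.+1 -> G}) (c d eps t : R).

Definition link (x : G) : {fset {ffun 'I_n.+1 -> G}} :=
  [fset f in cartprod [eta X with o |-> [fset x]] | f \in H].

Definition link_capacity : nat := \prod_(j < n) #|` X (lift o j)|.

Lemma upd_lift (T : Type) (Y : 'I_n.+1 -> T) (y : T) (j : 'I_n) :
  [eta Y with o |-> y] (lift o j) = Y (lift o j).
Proof. by rewrite /= eq_sym (negPf (neq_lift o j)). Qed.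

Lemma card_cartprod_pin (x : G) :
  #|` cartprod [eta X with o |-> [fset x]]| = link_capacity.
Proof.
rewrite card_cartprod (bigD1_ord o) //.
under eq_bigr do rewrite upd_lift.
by rewrite /= eqxx cardfs1 mul1n.
Qed.

Lemma link_capacity_gt0 : (0 < link_capacity)%N.
Proof. by apply: prodn_gt0 => j; rewrite cardfs_gt0. Qed.

Lemma card_link_le (x : G) : (#|` link x| <= link_capacity)%N.
Proof.
rewrite -(card_cartprod_pin x); apply: fsubset_leq_card.
by apply/fsubsetP => f; rewrite !inE => /andP[].
Qed.

Lemma sum_card_link :
  (\sum_(x <- X o) #|` link x| = #|` [fset f in cartprod X | f \in H]|)%N.
Proof.
have fX_o : {in [fset f in cartprod X | f \in H], forall f, f o \in X o}.
  by move=> f; rewrite !inE => /andP[/cartprodP].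
rewrite -(card_fibers fX_o).
rewrite big_seq [RHS]big_seq; apply: eq_bigr => x xX; congr #|` _|.
apply/fsetP => f; rewrite !inE andbAC; congr (_ && _).
apply/cartprodP/andP => [f_pin|[/cartprodP fX /eqP fo] i]; last first.
  by rewrite /=; case: eqP => // ->; rewrite inE fo.
have fo : f o = x by apply/eqP; have := f_pin o; rewrite /= eqxx inE.
split; last exact/eqP; apply/cartprodP => i; have := f_pin i.
by rewrite /=; case: eqP => // -> _; rewrite fo.
Qed.

Lemma card_dense_links d : 0 <= d -> edge_dense H d X ->
  d / 2 * #|` X o|%:R
  <= #|` [fset x in X o | d / 2 * link_capacity%:R <= #|` link x|%:R]|%:R.
Proof.
move=> d_ge0 dX; set m : R := link_capacity%:R.
have m_gt0 : 0 < m by rewrite ltr0n link_capacity_gt0.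
have t_ge0 : 0 <= d / 2 * m by rewrite mulr_ge0 ?divr_ge0.
have sum_link : d * #|` X o|%:R * m <= \sum_(x <- X o) #|` link x|%:R.
  rewrite -natr_sum sum_card_link; apply: le_trans dX.
  by rewrite card_cartprod (bigD1_ord o) //= natrM mulrA.
rewrite -(ler_pM2r m_gt0) card_fset_cond natr_sum mulr_suml.
apply: (@le_trans _ _
    (\sum_(x <- X o) #|` link x|%:R - d / 2 * m * #|` X o|%:R)).
  by move: sum_link; lra.
apply: le_trans (sum_popular_ge _ _ t_ge0) _; rewrite big_mkcond.
apply: ler_sum => x _; case: ifP => _; rewrite ?mul1r ?mul0r // ler_nat.
exact: card_link_le.
Qed.

Definition popular_link t a : {fset {ffun 'I_n.+1 -> G}} :=
  [fset f in link (a o) |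
     [forall j, popular H t X (lift o j) (a (lift o j) - f (lift o j))]].

Lemma card_unpopular_link_le t eps a (j : 'I_n) :
  #|` [fset b in X (lift o j) |
         ~~ popular H t X (lift o j) (a (lift o j) - b)]|%:R
    <= 2 * eps * #|` X (lift o j)|%:R ->
  #|` [fset f in link (a o) |
         ~~ popular H t X (lift o j) (a (lift o j) - f (lift o j))]|%:R
    <= 2 * eps * link_capacity%:R.
Proof.
set bad := [fset b in _ | _] => bad_le; set bad_link := [fset f in _ | _].
pose pin := [eta X with o |-> [fset a o]].
have cX_gt0 : 0 < #|` X (lift o j)|%:R :> R by rewrite ltr0n cardfs_gt0.
have m_gt0 : 0 < link_capacity%:R :> R by rewrite ltr0n link_capacity_gt0.
rewrite -(ler_pM2l cX_gt0).
apply: (@le_trans _ _ (#|` bad| * #|` cartprod pin|)%:R); last first.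
  by rewrite natrM card_cartprod_pin mulrA ler_pM2r // mulrC.
rewrite -natrM ler_nat -(card_cartprod_upd pin (lift o j)) /pin upd_lift.
rewrite leq_mul2l; apply/orP; right.
apply: fsubset_leq_card; apply/fsubsetP => f; rewrite !inE.
move=> /andP[/andP[/cartprodP f_pin _] unpopular]; apply/cartprodP => i.
rewrite [[eta _ with _ |-> bad] _]/=; case: eqP => [->|_]; last exact: f_pin.
by have := f_pin (lift o j); rewrite upd_lift !inE unpopular => ->.
Qed.

Lemma card_popular_link_ge t d eps a :
  eps * n%:R <= d / 8 -> d / 2 * link_capacity%:R <= #|` link (a o)|%:R ->
  (forall j : 'I_n,
     #|` [fset b in X (lift o j) |
            ~~ popular H t X (lift o j) (a (lift o j) - b)]|%:R
     <= 2 * eps * #|` X (lift o j)|%:R) ->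
  d / 4 * link_capacity%:R <= #|` popular_link t a|%:R.
Proof.
move=> eps_le link_ge few.
have := leq_card_fset_forall (fun (j : 'I_n) f =>
  popular H t X (lift o j) (a (lift o j) - f (lift o j))) (link (a o)).
rewrite -(ler_nat R) natrD natr_sum -/(popular_link t a).
set unpopular := \sum_j _ => link_le.
have : unpopular <= \sum_(j < n) 2 * eps * link_capacity%:R.
  by apply: ler_sum => j _; exact: card_unpopular_link_le.
rewrite sumr_const card_ord -[_ *+ n]mulr_natr.
have := ler_wpM2r (ler0n R link_capacity) eps_le.
by move: link_ge link_le; lra.
Qed.

Lemma card_sum_diff_reps_ge t c a (w : 'I_n -> 'I_n.+1) :
  0 <= t -> (forall j, w j != lift o j) -> c <= #|` popular_link t a|%:R ->
  c * \prod_(j < n) (t * #|` X (w j)|%:R)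
  <= #|` sum_diff_reps n (hsum H) (\sum_i a i)|%:R.
Proof.
move=> t_ge0 w_neq c_le.
have link_sum :
    {in popular_link t a, forall f, \sum_i f i \in hsum H /\ f o = a o}.
  move=> f; rewrite !inE => /andP[/andP[/cartprodP f_pin fH] _].
  by split; [exact: mem_hsum | have := f_pin o; rewrite /= eqxx inE => /eqP].
have := sum_prod_diff_reps_le link_sum; rewrite -(ler_nat R); apply: le_trans.
have prod_ge0 : 0 <= \prod_(j < n) (t * #|` X (w j)|%:R).
  by apply: prodr_ge0 => j _; rewrite mulr_ge0.
apply: le_trans (ler_wpM2r prod_ge0 c_le) _.
rewrite natr_sum mulr_natl -sumr_const_seq big_seq [leRHS]big_seq.
apply: ler_sum => f; rewrite !inE => /andP[_ /forallP f_popular].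
rewrite natr_prod; apply: ler_prod => j _; rewrite mulr_ge0 //=.
by have /forallP/(_ (w j))/implyP/(_ (w_neq j)) := f_popular j.
Qed.

Lemma card_sumset_le t c (A' : 'I_n.+1 -> {fset G}) (w : 'I_n -> 'I_n.+1) :
  0 <= t -> (forall j, w j != lift o j) ->
  {in cartprod A', forall a, c <= #|` popular_link t a|%:R} ->
  c * \prod_(j < n) (t * #|` X (w j)|%:R) * #|` sumset A'|%:R
  <= #|` hsum H|%:R ^+ (2 * n).+1.
Proof.
move=> t_ge0 w_neq c_le; rewrite -natrX mulr_natr -sumr_const_seq big_seq.
apply: (@le_trans _ _
    (\sum_(q <- sumset A') #|` sum_diff_reps n (hsum H) q|)%:R).
  rewrite natr_sum [leRHS]big_seq.
  apply: ler_sum => _ /imfsetP[a /= /c_le c_le_a ->].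
  exact: card_sum_diff_reps_ge.
by rewrite ler_nat sum_card_sum_diff_reps_le.
Qed.

End Links.

Definition other_part n (o m : 'I_n.+1) (j : 'I_n) : 'I_n.+1 :=
  if m == lift o j then o else m.

Lemma other_part_neq n (o m : 'I_n.+1) j : other_part o m j != lift o j.
Proof. by rewrite /other_part; case: ifPn => // _; exact: neq_lift. Qed.

Lemma prod_other_part (R : comNzRingType) n (o m : 'I_n.+1) (x : 'I_n.+1 -> R) :
  (0 < n)%N ->
  \prod_(j < n) x (lift o j) * \prod_(j < n) x (other_part o m j)
  = \prod_i x i * x m ^+ n.-1.
Proof.
move=> n_gt0; rewrite [in RHS](bigD1_ord o) //= mulrC mulrAC; congr (_ * _).
case: (unliftP o m) => [m0 ->|->].
  rewrite (bigD1 m0) //= {1}/other_part eqxx; congr (_ * _).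
  rewrite (eq_bigr (fun=> x (lift o m0))) => [|j jm0].
    by rewrite prodr_const cardC1 card_ord.
  by rewrite /other_part (inj_eq lift_inj) eq_sym (negPf jm0).
rewrite (eq_bigr (fun=> x o)) => [|j _]; last by rewrite /other_part; case: ifP.
by rewrite prodr_const card_ord -exprS prednK.
Qed.

Lemma prod_exp_pred_ge (R : numDomainType) n (o m : 'I_n.+1) (c : R)
    (x y : 'I_n.+1 -> R) :
  (0 < n)%N -> 0 <= c -> (forall i, 0 <= y i) ->
  (forall i, c * y i <= x i) -> x o = y o ->
  c ^+ (2 * n).-1 * (\prod_i y i * y m ^+ n.-1) <= \prod_i x i * x m ^+ n.-1.
Proof.
move=> n_gt0 c_ge0 y_ge0 yx xo.
have -> : (2 * n).-1 = (n + n.-1)%N by lia.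
rewrite exprD mulrACA -exprMn; apply: ler_pM.
- by rewrite mulr_ge0 ?exprn_ge0 ?prodr_ge0.
- by rewrite exprn_ge0 ?mulr_ge0.
- rewrite (bigD1_ord o) //= [leRHS](bigD1_ord o) //= xo mulrCA ler_wpM2l //.
  rewrite -[n in c ^+ n]card_ord -prodr_const -big_split /=.
  by apply: ler_prod => j _; rewrite yx andbT mulr_ge0.
- by rewrite lerXn2r ?nnegrE ?mulr_ge0 // (le_trans _ (yx m)) ?mulr_ge0.
Qed.

Lemma geometric_mean_cancel (R : numDomainType) n (D E C N y S Q : R) :
  (0 < n)%N -> 0 <= D -> 0 <= E -> 0 < N -> N <= y -> 0 <= S -> S <= C * N ->
  0 <= Q -> D * (N ^+ n.+1 * y ^+ n.-1) * Q <= E * S ^+ (2 * n).+1 ->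
  D * Q <= E * C ^+ (2 * n).+1 * N.
Proof.
move=> n_gt0 D_ge0 E_ge0 N_gt0 Ny S_ge0 S_le Q_ge0 DQ.
have N2n_gt0 : 0 < N ^+ (2 * n) by rewrite exprn_gt0.
rewrite -(ler_pM2r N2n_gt0); apply: le_trans (le_trans DQ _).
  rewrite mulrAC ler_wpM2r // ler_wpM2l //.
  have -> : (2 * n = n.+1 + n.-1)%N by lia.
  rewrite exprD ler_wpM2l ?exprn_ge0 ?(ltW N_gt0) //.
  by rewrite lerXn2r ?nnegrE // (le_trans (ltW N_gt0)).
rewrite -!mulrA -exprS -exprMn ler_wpM2l //.
by rewrite lerXn2r ?nnegrE // (le_trans S_ge0).
Qed.

Lemma density_powerE (R : realFieldType) n (d : R) : (0 < n)%N ->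
  d ^+ (5 * n) = (2 ^+ 10 * n%:R) ^+ n *
    (d / 4 * (d / (8 * n%:R) * d ^+ 2 / 8) ^+ n * (d / 4) ^+ (2 * n).-1).
Proof.
move=> n_gt0; set t := d / (8 * n%:R) * d ^+ 2 / 8.
have -> : d / 4 * t ^+ n * (d / 4) ^+ (2 * n).-1 = (t * (d / 4) ^+ 2) ^+ n.
  by rewrite mulrAC -exprS prednK ?muln_gt0 // mulrC exprM [RHS]exprMn.
rewrite -exprMn exprM; congr (_ ^+ n); rewrite /t; field.
by rewrite pnatr_eq0 -lt0n.
Qed.

Section LargeSubsets.
Variables (R : realFieldType) (G : zmodType) (n : nat).
Variables (A : 'I_n.+1 -> {fset G}) (H : {fset {ffun 'I_n.+1 -> G}}).
Variable delta : R.
Hypotheses (n_gt0 : (0 < n)%N) (delta_gt0 : 0 < delta).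
Hypotheses (A_neq0 : forall i, A i != fset0) (A_dense : edge_dense H delta A).

Local Notation o := (@ord_max n).
Local Notation d := (delta / 2 ^+ n).
Local Notation eps := (d / (8 * n%:R)).
Local Notation t := (eps * d ^+ 2 / 8).

Lemma final_density_gt0 : 0 < d.
Proof. by rewrite divr_gt0 ?exprn_gt0. Qed.

Lemma final_density_le k : (k <= n)%N -> d <= delta / 2 ^+ k.
Proof.
move=> kn; rewrite ler_pM2l // lef_pV2 ?posrE ?exprn_gt0 //.
by rewrite ler_weXn2l // ler1n.
Qed.

Lemma eps_gt0 : 0 < eps.
Proof. by rewrite divr_gt0 ?final_density_gt0 // mulr_gt0 // ltr0n. Qed.

Lemma exists_typical_before_last : exists X A' : 'I_n.+1 -> {fset G},
  [/\ forall i, X i `<=` A i, X o = A o, edge_dense H d X,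
      forall i, d / 4 * #|` A i|%:R <= #|` X i|%:R
    & forall j : 'I_n, typical H t eps (delta / 2 ^+ j) X (lift o j)
                         (A (lift o j)) (A' (lift o j))].
Proof.
have [X [A' [XA XE dX typX]]] :=
  exists_typical delta_gt0 eps_gt0 A_neq0 A_dense (leqnSn n).
have typ_lift (j : 'I_n) : typical H t eps (delta / 2 ^+ j) X (lift o j)
    (A (lift o j)) (A' (lift o j)).
  by have := typX (lift o j); rewrite lift_max; apply; exact: ltn_ord.
exists X, A'; split=> // [|i]; first exact: XE.
case: (unliftP o i) => [j ->|->].
  have [_ cX _ _] := typ_lift j; apply: le_trans cX.
  by rewrite ler_wpM2r // ler_pM2r ?invr_gt0 // final_density_le // ltnW.
rewrite XE // ler_piMl //; have := final_density_le (leq0n n).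
by rewrite expr0 divr1; have := edge_dense_le1 A_neq0 A_dense; lra.
Qed.

Lemma exists_popular_links : exists X A' : 'I_n.+1 -> {fset G},
  [/\ X o = A o, forall i, d / 4 * #|` A i|%:R <= #|` X i|%:R,
      forall i, A' i `<=` A i,
      forall i : 'I_n.+1, delta / 2 ^+ i / 8 * #|` A i|%:R <= #|` A' i|%:R
    & {in cartprod A', forall a,
         d / 4 * (link_capacity o X)%:R <= #|` popular_link o H X t a|%:R}].
Proof.
have d_gt0 := final_density_gt0.
have [X [A' [XA Xo dX X_ge typX]]] := exists_typical_before_last.
have X_neq0 i : X i != fset0.
  rewrite -cardfs_gt0 -(ltr0n R); apply: lt_le_trans (X_ge i).
  by rewrite mulr_gt0 ?ltr0n ?cardfs_gt0 // divr_gt0.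
have last_ge := card_dense_links o X_neq0 (ltW d_gt0) dX.
set last := [fset x in X o | _] in last_ge.
exists X, [eta A' with o |-> last]; split=> // [i|i|a /cartprodP aA'].
- apply: fsubset_trans (XA i); case: (unliftP o i) => [j ->|->].
    by rewrite upd_lift; have [] := typX j.
  by rewrite /= eqxx; apply/fsubsetP => x; rewrite !inE => /andP[].
- case: (unliftP o i) => [j ->|->].
    by rewrite upd_lift lift_max; have [] := typX j.
  rewrite /= eqxx; apply: le_trans last_ge; rewrite Xo ler_wpM2r //=.
  by move: d_gt0; lra.
apply: (card_popular_link_ge X_neq0 (eps := eps)) => [||j].
- by rewrite [(8 * _)^-1]invfM mulrA divfK // pnatr_eq0 -lt0n.
- by have := aA' o; rewrite /= eqxx !inE => /andP[].
have [_ _ _] := typX j; apply.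
by have := aA' (lift o j); rewrite upd_lift.
Qed.

Lemma exists_subsets_card_sumset_le : exists A' : 'I_n.+1 -> {fset G},
  [/\ forall i, A' i `<=` A i,
      forall i : 'I_n.+1, delta / 2 ^+ i / 8 * #|` A i|%:R <= #|` A' i|%:R
    & forall m, d ^+ (5 * n) * (\prod_i #|` A i|%:R * #|` A m|%:R ^+ n.-1)
          * #|` sumset A'|%:R
        <= (2 ^+ 10 * n%:R) ^+ n * #|` hsum H|%:R ^+ (2 * n).+1].
Proof.
have d_ge0 := ltW final_density_gt0.
have [X [A' [Xo X_ge A'A cA' links_ge]]] := exists_popular_links.
exists A'; split=> // m.
have t_ge0 : 0 <= t by rewrite divr_ge0 // mulr_ge0 ?sqr_ge0 // ltW ?eps_gt0.
have := card_sumset_le t_ge0 (other_part_neq o m) links_ge.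
rewrite -(ler_pM2l (_ : 0 < (2 ^+ 10 * n%:R) ^+ n)); last first.
  by rewrite exprn_gt0 // mulr_gt0 ?exprn_gt0 ?ltr0n.
apply: le_trans; rewrite [leRHS]mulrA ler_wpM2r //.
rewrite density_powerE // -mulrA.
rewrite ler_wpM2l ?exprn_ge0 ?mulr_ge0 //.
rewrite big_split /= prodr_const card_ord natr_prod.
have /= prod_other := prod_other_part o m (fun i => #|` X i|%:R) n_gt0.
rewrite [leRHS]mulrACA prod_other -mulrA ler_wpM2l //; last first.
  apply: (prod_exp_pred_ge (o := o) m n_gt0 _ _ X_ge); rewrite ?Xo //.
  by rewrite divr_ge0.
by rewrite mulr_ge0 ?exprn_ge0 // divr_ge0.
Qed.

Lemma exists_large_subsets_small_sumset (C N : R) :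
  0 < N -> N ^+ n.+1 = \prod_i #|` A i|%:R -> #|` hsum H|%:R <= C * N ->
  exists A' : 'I_n.+1 -> {fset G},
    [/\ forall i, A' i `<=` A i,
        forall i : 'I_n.+1, delta / 2 ^+ i / 8 * #|` A i|%:R <= #|` A' i|%:R
      & d ^+ (5 * n) * #|` sumset A'|%:R
        <= (2 ^+ 10 * n%:R) ^+ n * C ^+ (2 * n).+1 * N].
Proof.
move=> N_gt0 N_mean hsum_le.
have [A' [A'A cA' sum_le]] := exists_subsets_card_sumset_le.
have [m Nm] := exists_ge_geometric_mean (fun i => ler0n R _) N_mean.
exists A'; split=> //.
apply: (geometric_mean_cancel n_gt0 _ _ N_gt0 Nm _ hsum_le) => //.
- by rewrite exprn_ge0 // ltW // final_density_gt0.
- by rewrite exprn_ge0 // mulr_ge0 ?exprn_ge0.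
by rewrite N_mean.
Qed.

End LargeSubsets.

Lemma edge_dense_subset (R : realFieldType) (G : zmodType) r
    (A : 'I_r -> {fset G}) (H : {fset {ffun 'I_r -> G}}) (d : R) :
  H `<=` cartprod A -> d * \prod_i #|` A i|%:R <= #|` H|%:R -> edge_dense H d A.
Proof.
move=> HA cH; rewrite /edge_dense card_cartprod natr_prod.
rewrite (_ : [fset f in _ | _] = H) //; apply/fsetP => f.
by rewrite !inE andbC andb_idr // => /(fsubsetP HA).
Qed.

Lemma sumset_constant_le (R : realType) n (K : R) : (0 < n)%N -> 1 <= K ->
  (2 ^+ 10 * n%:R) ^+ n * (K * 2 ^+ n) ^+ (5 * n)
  <= 8 ^+ (n.+1 ^ 3) * n%:R ^+ n
     * K `^ ((n.+1%:R ^+ 2 + 5 * n.+1%:R - 4) / 2).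
Proof.
move=> n_gt0 K_ge1; have K_gt0 : 0 < K by exact: lt_le_trans K_ge1.
have -> : (2 ^+ 10 * n%:R) ^+ n * (K * 2 ^+ n) ^+ (5 * n)
    = 2 ^+ (10 * n + n * (5 * n)) * n%:R ^+ n * K ^+ (5 * n) :> R.
  rewrite exprMn [(K * _) ^+ _]exprMn -!exprM exprD [K ^+ _ * _]mulrC mulrA.
  by congr (_ * _); rewrite mulrAC.
apply: ler_pM; rewrite ?mulr_ge0 ?exprn_ge0 ?(ltW K_gt0) //.
  rewrite ler_wpM2r ?exprn_ge0 // (_ : 8 = 2 ^+ 3); last by ring.
  by rewrite -exprM ler_weXn2l ?ler1n //; nia.
rewrite -(powR_mulrn (5 * n) (ltW K_gt0)) ler_powR //.
have : (3 * n <= n * n + 2)%N by case: n n_gt0 => [|[|[|k]]] // _; nia.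
rewrite -(ler_nat R) !natrD !natrM -(natr1 n); lra.
Qed.

Theorem theorem1p4 (R : realType) (r : nat) (hr : (2 <= r)%N)
    (K C : R) (hK : 0 < K) (hC : 0 < C)
    (G : zmodType) (A : 'I_r -> {fset G}) (hA : forall i, A i != fset0)
    (H : {fset {ffun 'I_r -> G}}) (hHA : H `<=` cartprod A)
    (hH : (#|` H|)%:R >= 1 / K * \prod_(i < r) (#|` A i|)%:R)
    (hsumH : (#|` hsum H|)%:R <=
       C * (\prod_(i < r) (#|` A i|)%:R) `^ (1 / r%:R)) :
  exists A' : 'I_r -> {fset G},
    [/\ forall i, A' i `<=` A i,
        (* i is 0-based, hence i.+1 in the exponent *)
        forall i, (#|` A' i|)%:R >= (#|` A i|)%:R / (2 ^+ (i.+1 + 2) * K)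
      & (#|` sumset A'|)%:R <=
          8 ^+ (r ^ 3) * (r%:R - 1) ^+ (r - 1)
          * K `^ ((r%:R ^+ 2 + 5 * r%:R - 4) / 2) * C ^+ (2 * r - 1)
          * (\prod_(i < r) (#|` A i|)%:R) `^ (1 / r%:R)].
Proof.
case: r hr A hA H hHA hH hsumH => [//|n] n_gt0 A hA H hHA hH hsumH.
rewrite div1r in hH; have K_inv_gt0 : 0 < K^-1 by rewrite invr_gt0.
have A_dense := edge_dense_subset hHA hH.
have K_ge1 : 1 <= K by have := edge_dense_le1 hA A_dense; rewrite invf_le1.
set P := \prod_(i < _) _ in hsumH *; set N := P `^ _ in hsumH *.
have P_gt0 : 0 < P by apply: prodr_gt0 => i _; rewrite ltr0n cardfs_gt0.
have N_gt0 : 0 < N by exact: powR_gt0.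
have N_mean : N ^+ n.+1 = P.
  rewrite -powR_mulrn ?ltW // -powRrM mul1r mulVf ?pnatr_eq0 //.
  by rewrite powRr1 // ltW.
have [A' [A'A cA' sum_le]] := exists_large_subsets_small_sumset
  n_gt0 K_inv_gt0 hA A_dense N_gt0 N_mean hsumH.
exists A'; split=> // [i|].
  apply: le_trans (cA' i); rewrite mulrC -!invfM addnC !exprS.
  by rewrite le_eqVlt; apply/orP; left; apply/eqP; congr (_^-1 * _); ring.
have K2n_gt0 : 0 < (K * 2 ^+ n) ^+ (5 * n) by rewrite !(exprn_gt0, mulr_gt0).
move: sum_le; rewrite -invfM exprVn ler_pdivrMl // => /le_trans; apply.
rewrite mulrA ler_wpM2r ?(ltW N_gt0) // mulrA [_ * _ ^+ n]mulrC.
rewrite (_ : (2 * n.+1 - 1 = (2 * n).+1)%N); last by lia.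
rewrite ler_wpM2r ?exprn_ge0 ?(ltW hC) // subn1 -[in n.+1%:R - 1]natr1 addrK.
exact: sumset_constant_le.
Qed.
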